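(* Let $q=p^n$ with $p$ an odd prime and $n\geqslant 1$, let $m\geqslant 1$, let $N=q^{1+2m}_{+}$, and let $H=\mathrm{Aut}(N)^{\mathbf{Z}(N)}\cong \Gamma\mathrm{L}(1,q)$ be the group induced by $\mathrm{Aut}(N)$ on $\mathbf{Z}(N)$. Let $U<\mathbf{Z}(N)$ be a proper subgroup. Then $N/U$ is a $3$-orbit group if and only if the setwise stabilizer $H_U$ acts transitively on the non-identity elements of $\mathbf{Z}(N)/U\cong\mathbf{Z}(N/U)$.
   Context: A group is a $3$-orbit group if its automorphism group has exactly three orbits on its elements. For $q=p^n$ with $p$ an odd prime, $q^{1+2}_+$ is the group of all upper unitriangular $3\times 3$ matrices over $\mathbb{F}_q$, and $q^{1+2m}_+$ is the central product of $m$ copies of it, namely $(q^{1+2}_+)^m/C$ with $C=\{(X_1,\dots,X_m)\in\mathbf{Z}(q^{1+2}_+)^m : X_1\cdots X_m=1\}$. $\Gamma\mathrm{L}(1,q)$ is the group of maps $x\mapsto \lambda x^\sigma$ of $\mathbb{F}_q$ with $\lambda\in\mathbb{F}_q^\times$, $\sigma\in\mathrm{Aut}(\mathbb{F}_q)$. *)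

(* Defs.v *)
From HB Require Import structures.
From mathcomp Require Import all_boot all_order all_algebra all_fingroup all_solvable.

Set Implicit Arguments.
Unset Strict Implicit.
Unset Printing Implicit Defensive.

Local Open Scope group_scope.

Definition three_orbit (gT : finGroupType) (G : {group gT}) : bool :=
  #|orbit 'P (Aut G) @: G| == 3.

(* A^Z for A = Aut G and Z = 'Z(G): the permutations that the automorphisms
   of G induce on its centre (extended by the identity outside 'Z(G)). *)
Definition Aut_on_center (gT : finGroupType) (G : {group gT}) :
    {group {perm gT}} :=
  (restr_perm 'Z(G) @* Aut G)%G.

Section GammaL1.

Variable F : finFieldType.

Definition is_field_aut (s : {perm F}) : bool :=
  [&& s 1%R == 1%R,
      [forall x, forall y, s (x + y)%R == (s x + s y)%R]
    & [forall x, forall y, s (x * y)%R == (s x * s y)%R]].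

(* GammaL(1,q): the maps x |-> l * s x, l a nonzero scalar, s in Aut(F). *)
Definition GammaL1_set : {set {perm F}} :=
  [set g : {perm F} | [exists l : F, exists s : {perm F},
     [&& l != 0%R, is_field_aut s & [forall x, g x == (l * s x)%R]]]].

Lemma group_set_GammaL1 : group_set GammaL1_set.
Proof.
apply/group_setP; split.
  rewrite inE; apply/existsP; exists 1%R; apply/existsP; exists 1.
  rewrite GRing.oner_neq0 /=; apply/andP; split.
    apply/and3P; split; first by rewrite perm1.
      by apply/'forall_'forall_eqP => x y; rewrite !perm1.
    by apply/'forall_'forall_eqP => x y; rewrite !perm1.
  by apply/'forall_eqP => x; rewrite perm1 GRing.mul1r.
move=> g h; rewrite !inE => /existsP[l /existsP[s /and3P[l0 sA /'forall_eqP gE]]].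
move=> /existsP[k /existsP[t /and3P[k0 tA /'forall_eqP hE]]].
case/and3P: sA => /eqP s1 /'forall_'forall_eqP sD /'forall_'forall_eqP sM.
case/and3P: tA => /eqP t1 /'forall_'forall_eqP tD /'forall_'forall_eqP tM.
have t0 : t 0%R = 0%R.
  by apply: (@GRing.addrI _ (t 0%R)); rewrite -tD !GRing.addr0.
apply/existsP; exists (k * t l)%R; apply/existsP; exists (s * t).
apply/and3P; split.
- by rewrite GRing.mulf_neq0 // -t0 (inj_eq perm_inj).
- apply/and3P; split; first by rewrite permM s1 t1.
    by apply/'forall_'forall_eqP => x y; rewrite !permM sD tD.
  by apply/'forall_'forall_eqP => x y; rewrite !permM sM tM.
- by apply/'forall_eqP => x; rewrite !permM gE hE tM GRing.mulrA.
Qed.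

Canonical GammaL1 := Group group_set_GammaL1.

End GammaL1.

Section CentralProduct.

Variables (F : finFieldType) (m : nat).

(* q^{1+2}_+, realised inside GL_3(F). *)
Definition UT3_set : {set {'GL_3[F]}} :=
  [set A : {'GL_3[F]} |
     [forall i : 'I_3, forall j : 'I_3, (j <= i) ==> (GLval A i j == (i == j)%:R%R)]].

Lemma group_set_UT3 : group_set UT3_set.
Proof.
apply/group_setP; split.
  rewrite inE; apply/forallP => i; apply/forallP => j; apply/implyP => _.
  by rewrite GL_1E mxE.
move=> A B; rewrite !inE => /forallP hA /forallP hB.
have {}hA (i j : 'I_3) : j <= i -> GLval A i j = (i == j)%:R%R.
  by move/implyP: (forallP (hA i) j) => h /h /eqP.
have {}hB (i j : 'I_3) : j <= i -> GLval B i j = (i == j)%:R%R.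
  by move/implyP: (forallP (hB i) j) => h /h /eqP.
apply/forallP => i; apply/forallP => j; apply/implyP => ji.
rewrite GL_MxE mxE (bigD1 i) //= big1 => [|k ki].
  by rewrite hA // hB // eqxx GRing.mul1r GRing.addr0.
have [kltj|jlek] := leqP k i.
  by rewrite hA // eq_sym (negPf ki) GRing.mul0r.
rewrite hB; last by apply: leq_trans ji (ltnW jlek).
by rewrite -val_eqE gtn_eqF ?GRing.mulr0 // (leq_ltn_trans ji).
Qed.

Canonical UT3 := Group group_set_UT3.

Definition UT3_pow : {group {dffun forall i : 'I_m, {'GL_3[F]}}} :=
  setXn_group (fun _ : 'I_m => UT3).

(* The subgroup C amalgamating the centres in the central product. *)
Definition amalg_set : {set {dffun forall i : 'I_m, {'GL_3[F]}}} :=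
  [set X in setXn (fun _ : 'I_m => 'Z(UT3)) | \prod_(i < m) X i == 1].

Lemma group_set_amalg : group_set amalg_set.
Proof.
apply/group_setP; split.
  rewrite inE group1 /=; apply/eqP.
  by apply: big1 => i _; rewrite ffunE.
move=> X Y; rewrite !inE => /andP[/forallP XZ /eqP X1] /andP[/forallP YZ /eqP Y1].
apply/andP; split; first by apply/forallP => i; rewrite ffunE; apply: groupM (XZ i) (YZ i).
apply/eqP; under eq_bigr => i _ do rewrite ffunE.
suff [] : \prod_(i < m) (X i * Y i) = \prod_(i < m) X i * \prod_(i < m) Y i
  /\ \prod_(i < m) X i \in 'Z(UT3) by rewrite X1 Y1 mulg1.
elim/big_rec3: _ => [|i x y z _ [-> yZ]]; first by rewrite mulg1 group1.
split; last by apply: groupM (XZ i) yZ.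
rewrite !mulgA; congr (_ * _); rewrite -!mulgA; congr (_ * _).
by apply: (centsP (center_abelian UT3)) => //; apply: YZ.
Qed.

Canonical amalg := Group group_set_amalg.

(* q^{1+2m}_+ with q = #|F|. *)
Definition extraspecial_q : {group coset_of amalg} := (UT3_pow / amalg)%G.

End CentralProduct.

(* Main.v *)
Require Import Defs.
From mathcomp Require Import all_boot all_order all_algebra all_fingroup all_solvable.
From mathcomp Require Import finfield.
From mathcomp Require Import ring.

Set Implicit Arguments.
Unset Strict Implicit.
Unset Printing Implicit Defensive.

Import GRing.Theory.

Local Open Scope group_scope.
Local Open Scope ring_scope.

(** The group q^{1+2m}_+ is a Heisenberg group.  Put V = F^{2m} with its
    standard symplectic form B.  As q is odd, coordinates can be chosen in
    which the group is V x F with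
      (v, z) (w, y) = (v + w, z + y + B(v, w) / 2),
    so the centre is 0 x F and the commutator of (v, z) and (w, y) is B(v, w).
    If Uh is the additive subgroup of F that corresponds to U, then N / U has
    the same law with the last coordinate read modulo Uh.  The record
    [heisenberg] covers both groups, and everything is proved once for it.

    Two facts about such a quotient G carry the theorem.

    1. An automorphism of G acts on the centre F / Uh as some element of
       GammaL(1,q) that stabilizes Uh, and every such element arises
       ([heis_Aut_center], [heis_Aut_realize]).  With Uh = 0 this identifies
       the group H of the statement with GammaL(1,q).

    2. Aut(G) is transitive on G \ Z(G) ([heis_Aut_trans]): transvections
       move any non-zero vector of V to any other, and the automorphisms
       (v, z) |-> (v, z + B(v, x)) adjust the last coordinate.

    Hence {1} and G \ Z(G) are orbits, and the number of orbits is three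
    exactly when the stabilizer of Uh in GammaL(1,q) is transitive on the
    non-zero classes of F / Uh ([three_orbit_heisP]).

    The existence half of 1 is explicit.  The other half is the real point,
    since for U <> 1 an automorphism of N / U need not lift to N: if q > p and U
    is a hyperplane, then N / U is extraspecial and some of its automorphisms
    induce on V maps that are not F-semilinear.  An automorphism gives an additive
    bijection g of V and a map h of F / Uh with B(g x, g y) = h(B(x, y))
    modulo Uh.  Fix a non-zero functional f0 : F -> F_p that kills Uh; every
    functional is z |-> f0(a z) for some a, and those killing Uh form a space
    A of multipliers a.  The transpose h* of h acts on A, and nondegeneracy of
    the forms f0(a B) shows that conjugation by g turns multiplication by a
    into multiplication by h*(a) / h*(1).  Conjugation respects sums and
    products, so a |-> h*(a) / h*(1) extends to an embedding into F of the
    subring that A generates, hence it is a power of the Frobenius map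
    ([ring_relation_Frobenius]).  So h* is semilinear on A, and dualizing back
    exhibits h as semilinear modulo Uh ([similitude_mod_semilinear]). *)

(** * Functionals on a finite field over its prime field *)

Lemma morphD0 (M M' : zmodType) (f : M -> M') :
  {morph f : x y / x + y} -> f 0 = 0.
Proof. by move=> fD; apply: (@addrI _ (f 0)); rewrite -fD !addr0. Qed.

Lemma morphDB (M M' : zmodType) (f : M -> M') :
  {morph f : x y / x + y} -> {morph f : x y / x - y}.
Proof. by move=> fD x y; apply/eqP; rewrite eq_sym subr_eq -fD subrK. Qed.

Section Functionals.

Variables (p : nat) (F : finFieldType).
Hypothesis pcharF : p \in [pchar F].

Local Notation L := (pPrimeCharType pcharF).

Lemma additive_Fp_scale (f : F -> 'F_p) (a : 'F_p) (z : L) :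
  {morph f : x y / x + y} -> f (a *: z) = a * f z.
Proof.
move=> fD; have f0 := morphD0 fD.
have fMn k x : f (x *+ k) = f x *+ k.
  by elim: k => [|k IH]; rewrite ?mulr0n // !mulrS fD IH.
rewrite -[X in _ = X * _]natr_Zp mulr_natl -fMn; congr f.
exact: mulr_natl.
Qed.

(** Project w off the F_p-span of U, which is U itself because additive
    subgroups are F_p-subspaces; some coordinate of the remainder is non-zero. *)
Lemma separating_functional (U : {set F}) (w : F) :
  zmod_closed U -> w \notin U ->
  exists f : F -> 'F_p, [/\ {morph f : x y / x + y},
    forall u, u \in U -> f u = 0 & f w != 0].
Proof.
case=> U0 UB wU.
have UN u : u \in U -> - u \in U by move=> Uu; rewrite -sub0r UB.
have UD u v : u \in U -> v \in U -> u + v \in U.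
  by move=> Uu Uv; rewrite -[v]opprK UB ?UN.
have UMn u k : u \in U -> u *+ k \in U.
  by move=> Uu; elim: k => [|k IH]; rewrite ?mulr0n // mulrS UD.
pose W : {vspace L} := <<(enum U : seq L)>>%VS.
have sUW u : u \in U -> (u : L) \in W.
  by move=> Uu; apply: memv_span; rewrite mem_enum.
have WU (u : L) : u \in W -> u \in U.
  rewrite /W span_def big_tnth => /memv_sumP[c cP ->].
  elim/big_ind: _ => [||i _]; [exact: U0 | exact: UD |].
  have /vlineP[k ->] := cP i isT.
  have -> : k *: (tnth (in_tuple (enum U)) i : L) = (tnth (in_tuple (enum U)) i : F) *+ k.
    exact: mulr_natl.
  by apply: UMn; rewrite -mem_enum mem_tnth.
pose y := (w : L) - projv W w.
have y0 : y != 0.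
  apply: contraNneq wU => /eqP; rewrite subr_eq0 => /eqP wE.
  by apply: WU; rewrite wE memv_proj.
have [i fi] : exists i, coord (vbasis {:L}) i y != 0.
  apply/existsP; apply: contraR y0; rewrite negb_exists => /forallP c0.
  rewrite (coord_vbasis (memvf y)) big1 // => i _.
  by have /negPn/eqP -> := c0 i; rewrite scale0r.
exists (fun z : L => coord (vbasis {:L}) i (z - projv W z)); split=> //.
  move=> a b; rewrite -[RHS]raddfD; congr (coord _ _ _).
  by rewrite (raddfD (projv W) (a : L) b) opprD addrACA.
by move=> u /sUW Wu; rewrite projv_id // subrr linear0.
Qed.

(** The dual of F over F_p is a one-dimensional F-space, by counting: the map
    c |-> (z |-> f0(c z)) is injective since f0 is non-zero, and the dual has as
    many elements as F. *)
Lemma functional_mulE (f0 f : F -> 'F_p) (w : F) :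
    {morph f0 : x y / x + y} -> {morph f : x y / x + y} -> f0 w != 0 ->
  exists c, forall z, f z = f0 (c * z).
Proof.
move=> f0D fD f0w; pose b := vbasis {:L}; pose d := \dim {:L}.
pose Phi (c : L) : {ffun 'I_d -> 'F_p} := [ffun i : 'I_d => f0 (c * b`_i)].
have f00 := morphD0 f0D.
have expand (h : F -> 'F_p) z : {morph h : x y / x + y} ->
  h z = \sum_(i < d) coord b i (z : L) * h b`_i.
  move=> hD; have h0 := morphD0 hD.
  rewrite [in LHS](coord_vbasis (memvf (z : L))) (big_morph h hD h0).
  by apply: eq_bigr => i _; rewrite additive_Fp_scale.
have mulD (c : F) : {morph (fun z => f0 (c * z)) : x y / x + y}.
  by move=> x y; rewrite mulrDr f0D.
have PhiI : injective Phi.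
  move=> c c' eqc; apply/eqP; rewrite -subr_eq0; apply: contraNT f0w => cc'.
  have cE (e : F) z : f0 (e * z) = \sum_(i < d) coord b i (z : L) * Phi e i.
    rewrite (expand (fun z => f0 (e * z)) z (mulD e)).
    by apply: eq_bigr => i _; rewrite ffunE.
  rewrite -[w](mulVKf cc') mulrBl.
  have /eqP := cE c' ((c - c')^-1 * w); rewrite -eqc -cE => /eqP eqf.
  have := f0D (c * ((c - c')^-1 * w) - c' * ((c - c')^-1 * w)) (c' * ((c - c')^-1 * w)).
  by rewrite subrK eqf => /eqP; rewrite -subr_eq0 opprD addrCA subrr addr0 oppr_eq0.
have cardE : #|{ffun 'I_d -> 'F_p}| = #|L|.
  by rewrite card_ffun -(card_vspacef (Vector.class L)) card_vspace !card_ord.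
have /codomP[c cE] : [ffun i : 'I_d => f b`_i] \in codom Phi.
  by apply: inj_card_onto PhiI _ _; rewrite cardE.
exists c => z; rewrite expand // (expand (fun z => f0 (c * z))) //.
by apply: eq_bigr => i _; move/ffunP/(_ i): cE; rewrite !ffunE => ->.
Qed.

End Functionals.

(** * Embeddings of subrings of a finite field *)

Section RingRelation.

Variables (p n : nat) (F : finFieldType).
Hypotheses (pcharF : p \in [pchar F]) (cardF : #|F| = (p ^ n)%N).

(** X^p - X has at most p roots, and the p elements of the prime field are
    roots. *)
Lemma Frobenius_fixed_natr (x : F) : x ^+ p = x -> exists k, x = k%:R.
Proof.
move=> xp; have p_pr := pcharf_prime pcharF.
have [/mapP[k _ ->]|xs] := boolP (x \in [seq k%:R | k <- iota 0 p]).
  by exists k.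
have p_gt1 := prime_gt1 p_pr.
have natr_p k : (k%:R : F) ^+ p = k%:R.
  by rewrite -(pFrobenius_autE pcharF) pFrobenius_aut_nat.
have sizeP : size ('X^p - 'X : {poly F}) = p.+1.
  by rewrite size_polyDl size_polyXn // size_polyN size_polyX.
have P0 : ('X^p - 'X : {poly F}) != 0 by rewrite -size_poly_eq0 sizeP.
suff /(max_poly_roots P0) :
    all (root ('X^p - 'X : {poly F})) (x :: [seq k%:R | k <- iota 0 p]).
  rewrite sizeP /= size_map size_iota ltnn => H.
  suff /H : uniq (x :: [seq k%:R : F | k <- iota 0 p]) by [].
  rewrite cons_uniq xs map_inj_in_uniq ?iota_uniq // => i j.
  rewrite !mem_iota !add0n /= => ip jp.
  wlog ij : i j ip jp / (i <= j)%N.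
    by move=> W; case/orP: (leq_total i j) => le e; [|apply/esym]; apply: W.
  move/esym/eqP; rewrite -subr_eq0 -natrB // -(dvdn_pcharf pcharF) => dv.
  apply/eqP; rewrite eqn_leq ij leqNgt -subn_gt0 /=; apply/negP => d0.
  by have := dvdn_leq d0 dv; rewrite leqNgt (leq_ltn_trans (leq_subr i j)).
rewrite /= rootE !hornerE xp subrr eqxx /=.
by apply/allP => _ /mapP[k _ ->]; rewrite rootE !hornerE natr_p subrr.
Qed.

(** The relation T is the graph of an embedding into F of a subring K of F.
    The units of K are the powers of one element w.  The product of the
    X - w^(p^i) is fixed by the Frobenius map, so it has coefficients in the prime
    field, where T is the identity; hence the partner of w is again a root,
    that is, some w^(p^j), and j works for all powers of w. *)
Lemma ring_relation_Frobenius (T : rel F) :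
    T 1 1 ->
    (forall x x' y y', T x x' -> T y y' -> T (x - y) (x' - y')) ->
    (forall x x' y y', T x x' -> T y y' -> T (x * y) (x' * y')) ->
    (forall y, T 0 y -> y = 0) ->
  exists j, forall x y, T x y -> y = x ^+ (p ^ j).
Proof.
move=> T1 TB TM T0.
have T00 : T 0 0 by have := TB _ _ _ _ T1 T1; rewrite !subrr.
have TN x y : T x y -> T (- x) (- y).
  by move=> Txy; rewrite -[- x]sub0r -[- y]sub0r TB.
have TD x x' y y' : T x x' -> T y y' -> T (x + y) (x' + y').
  by move=> Tx Ty; rewrite -[y]opprK -[y']opprK TB // TN.
have TX x y k : T x y -> T (x ^+ k) (y ^+ k).
  by move=> Txy; elim: k => [|k IH] //; rewrite !exprS TM.
have Tnat k : T k%:R k%:R by elim: k => [|k IH] //; rewrite !mulrS TD.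
have Tfun x y y' : T x y -> T x y' -> y = y'.
  by move=> Ty Ty'; apply/eqP; rewrite -subr_eq0; apply/eqP/T0; rewrite -(subrr x) TB.
pose G : {set {unit F}} := [set u : {unit F} | [exists y, T (FinRing.uval u) y]].
have gG : group_set G.
  apply/group_setP; split; first by rewrite inE; apply/existsP; exists 1.
  move=> u v; rewrite !inE => /existsP[y Ty] /existsP[z Tz].
  by apply/existsP; exists (y * z); apply: TM.
have /cyclicP[w wE] : cyclic (Group gG) := field_unit_group_cyclic _.
have /existsP[w' Tw] : [exists y, T (FinRing.uval w) y].
  by have : w \in Group gG; [rewrite wE cycle_id | rewrite inE].
pose P : {poly F} := \prod_(i < n) ('X - (FinRing.uval w ^+ (p ^ i))%:P).
have p_pr := pcharf_prime pcharF.
have n0 : (0 < n)%N by case: n cardF (finNzRing_gt1 F) => // ->.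
have PF : map_poly (pFrobenius_aut pcharF) P = P.
  rewrite rmorph_prod /P -(prednK n0) big_ord_recr big_ord_recl /= mulrC.
  congr (_ * _).
    rewrite rmorphB /= map_polyX map_polyC /= pFrobenius_autE -exprM -expnSr.
    by rewrite prednK // -cardF expf_card expn0 expr1.
  apply: eq_bigr => i _.
  by rewrite rmorphB /= map_polyX map_polyC /= pFrobenius_autE -exprM -expnSr.
have Pnat i : exists k, P`_i = k%:R.
  apply: Frobenius_fixed_natr; rewrite -[in RHS]PF coef_map.
  by rewrite /= pFrobenius_autE.
have TP : T P.[FinRing.uval w] P.[w'].
  rewrite !horner_coef; elim/big_ind2: _ => [||i _] //.
    by move=> x x' y y'; apply: TD.
  by have [k ->] := Pnat i; apply: TM (Tnat k) (TX _ _ _ Tw).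
have /eqP : P.[w'] = 0.
  apply: T0; rewrite -[X in T X _](_ : P.[FinRing.uval w] = 0) //.
  rewrite /P horner_prod (bigD1 (Ordinal n0)) //= !hornerE expn0 expr1 subrr.
  by rewrite mul0r.
rewrite horner_prod prodf_seq_eq0 => /hasP[j _]; rewrite !hornerE subr_eq0 /=.
move=> /eqP w'E; exists j => x y Txy.
have [x0|x0] := eqVneq x 0.
  rewrite x0 expr0n gtn_eqF ?expn_gt0 ?prime_gt0 //=.
  by apply: T0; rewrite -x0.
have xU : x \is a GRing.unit by rewrite unitfE.
have : FinRing.unit F xU \in Group gG by rewrite inE; apply/existsP; exists y.
rewrite wE => /cycleP[k /(congr1 (@FinRing.uval F))]; rewrite FinRing.val_unitX /= => xE.
apply: (Tfun x) => //; rewrite {1 2}xE -exprM mulnC exprM -w'E.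
exact: TX.
Qed.

End RingRelation.

(** * Symplectic forms and their similitudes *)

Lemma Frobenius_power_inv (p n : nat) (F : finFieldType) (j : nat) :
  #|F| = (p ^ n)%N -> exists k, forall x : F, x ^+ (p ^ j) ^+ (p ^ k) = x.
Proof.
move=> cardF; exists (n * j - j)%N => x.
(* The exponents add up to n j, and x ^ q = x. *)
rewrite -exprM -expnD.
case: n cardF (finNzRing_gt1 F) => [->//|n cardF _].
rewrite subnKC; last by rewrite mulSn leq_addr.
rewrite expnM -cardF; elim: j => [|j IH]; first by rewrite expn0 expr1.
by rewrite expnS exprM expf_card.
Qed.

Record symplectic (F : fieldType) (V : lmodType F) (B : V -> V -> F) : Prop :=
  Symplectic {
    sympDl : forall x y z, B (x + y) z = B x z + B y z;
    sympDr : forall x y z, B z (x + y) = B z x + B z y;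
    sympZl : forall c x y, B (c *: x) y = c * B x y;
    sympZr : forall c x y, B x (c *: y) = c * B x y;
    sympxx : forall x, B x x = 0;
    symp_nondeg : forall x, x != 0 -> exists y, B x y != 0 }.

Section SymplecticForm.

Variables (F : finFieldType) (V : finLmodType F) (B : V -> V -> F).
Hypothesis sB : symplectic B.

Let BDl := sympDl sB.
Let BDr := sympDr sB.
Let BZl := sympZl sB.
Let BZr := sympZr sB.
Let Bxx := sympxx sB.
Let Bnd := symp_nondeg sB.

Lemma sympC x y : B y x = - B x y.
Proof.
apply/eqP; rewrite -addr_eq0; apply/eqP.
by have := Bxx (y + x); rewrite BDl !BDr !Bxx add0r addr0.
Qed.

Lemma symp0r x : B x 0 = 0.
Proof. by rewrite -(scale0r x) BZr mul0r. Qed.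

Lemma form_onto (x : V) (z : F) : x != 0 -> exists y, B x y = z.
Proof.
by move=> /Bnd[y y0]; exists ((z / B x y) *: y); rewrite BZr divfK.
Qed.

(** The linear-algebra core: an additive similitude of B modulo U, with
    multiplier h, forces h to be semilinear modulo U, although g itself need
    not be semilinear. *)
Lemma similitude_mod_semilinear (p n : nat) (U : {set F}) (w : F) (x0 : V)
    (g : V -> V) (h : F -> F) :
    p \in [pchar F] -> #|F| = (p ^ n)%N ->
    zmod_closed U -> w \notin U -> x0 != 0 ->
    {morph g : x y / x + y} -> injective g ->
    (forall y z, h (y + z) - (h y + h z) \in U) ->
    (forall x y, B (g x) (g y) - h (B x y) \in U) ->
  exists c j, c != 0 /\ forall z, c * z ^+ (p ^ j) - h z \in U.
Proof.
move=> pF cardF Uz wU x00 gD gI hD Bgh.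
have [f0 [f0D f0U f0w]] := separating_functional pF Uz wU.
have f00 := morphD0 f0D.
have f0N u : f0 (- u) = - f0 u by rewrite -sub0r (morphDB f0D) f00 sub0r.
have f0B x y : f0 (x - y) = 0 -> f0 x = f0 y.
  by rewrite (morphDB f0D) => /eqP; rewrite subr_eq0 => /eqP.
(* A is the annihilator of U, with functionals written as multipliers. *)
pose A a := forall u, u \in U -> f0 (a * u) = 0.
have A1 : A 1 by move=> u Uu; rewrite mul1r f0U.
have adj a : A a -> exists b, forall z, f0 (a * h z) = f0 (b * z).
  move=> Aa; pose f z := f0 (a * h z).
  have fD : {morph f : x y / x + y}.
    by move=> x y; rewrite /f -f0D -mulrDr; apply: f0B; rewrite -mulrBr Aa.
  have [b bE] := functional_mulE pF f0D fD f0w.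
  by exists b => z; rewrite -bE.
have [l lE] := adj 1 A1.
have g0 := morphD0 gD; have gB := morphDB gD.
have g_onto x : exists y, g y = x by exists (invF gI x); rewrite f_invF.
have nondeg v : (forall y, f0 (B v (g y)) = 0) -> v = 0.
  move=> v0; apply/eqP; apply: contraNT f0w => vn0.
  by have [y <-] := form_onto w vn0; have [y' <-] := g_onto y; rewrite v0.
have Bf a x y : A a -> f0 (a * B (g x) (g y)) = f0 (a * h (B x y)).
  by move=> Aa; apply: f0B; rewrite -mulrBr Aa.
have l0 : l != 0.
  apply: contra_neq x00 => l0; have [y <-] := g_onto x0; apply: nondeg => z.
  by rewrite -[B _ _]mul1r Bf // lE l0 mul0r.
(* T e e' : conjugation by g turns multiplication by e into that by e'. *)
pose T : rel F := fun e e' => [forall x, e *: g x == g (e' *: x)].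
have TP e e' : reflect (forall x, e *: g x = g (e' *: x)) (T e e').
  exact: 'forall_eqP.
have T_A a b : A a -> (forall z, f0 (a * h z) = f0 (b * z)) -> T a (b / l).
  move=> Aa bE; apply/TP => x; apply/eqP; rewrite -subr_eq0; apply/eqP/nondeg=> y.
  rewrite -scaleN1r BDl !BZl mulN1r.
  rewrite f0D f0N Bf // -[X in - f0 X]mul1r Bf // bE lE.
  by rewrite (_ : l * _ = b * B x y) ?subrr // BZl; field.
have [j jE] : exists j, forall x y, T x y -> y = x ^+ (p ^ j).
  apply: (ring_relation_Frobenius pF cardF).
  - by apply/TP => x; rewrite !scale1r.
  - move=> a a' b b' /TP Ta /TP Tb; apply/TP => x.
    by rewrite !scalerBl Ta Tb gB.
  - move=> a a' b b' /TP Ta /TP Tb; apply/TP => x.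
    by rewrite -!scalerA Tb Ta scalerA mulrC -scalerA.
  - move=> y /TP/(_ x0); rewrite scale0r -[in LHS]g0 => /gI/esym/eqP.
    by rewrite scaler_eq0 (negPf x00) orbF => /eqP.
have [k kE] := Frobenius_power_inv j cardF.
have kE' (x : F) : x ^+ (p ^ k) ^+ (p ^ j) = x by rewrite exprAC kE.
have p_nat i : [pchar F].-nat (p ^ i)%N.
  by rewrite pnatX (eq_pnat _ (pcharf_eq pF)) pnat_id ?(pcharf_prime pF).
(* c transposes the Frobenius power: f0 (z ^ p^j) = f0 (c z). *)
have fsD : {morph (fun z => f0 (z ^+ (p ^ j))) : x y / x + y}.
  by move=> x y; rewrite exprDn_pchar // f0D.
have [c cE] := functional_mulE pF f0D fsD f0w.
exists (c * l ^+ (p ^ k)), k; split.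
  rewrite mulf_neq0 ?expf_neq0 //; apply: contraNneq f0w => c0.
  by rewrite -[w]kE' cE c0 mul0r f00.
(* It suffices to test against the functionals killing U, by separation. *)
move=> z; apply/negPn/negP => nU.
have [f1 [f1D f1U f1w]] := separating_functional pF Uz nU.
have [a aE] := functional_mulE pF f0D f1D f0w.
have Aa : A a by move=> u Uu; rewrite -aE f1U.
have [b bE] := adj a Aa.
have := jE _ _ (T_A a b Aa bE) => /(congr1 (fun t => t * l)); rewrite divfK // => b_E.
case/negP: f1w; apply/eqP; rewrite aE mulrBr.
rewrite f0D f0N bE b_E.
have -> : a * (c * l ^+ (p ^ k) * z ^+ (p ^ k)) = c * (a * (l * z) ^+ (p ^ k)).
  by rewrite exprMn !mulrA; congr (_ * _); rewrite [a * c]mulrC.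
by rewrite -cE exprMn kE' mulrA subrr.
Qed.

Definition isometry (g : V -> V) : Prop :=
  {morph g : x y / x + y} /\ forall x y, B (g x) (g y) = B x y.

Lemma transvection_isometry c u : isometry (fun v => v + (c * B v u) *: u).
Proof.
split=> [v w|v w]; first by rewrite BDl mulrDr scalerDl addrACA.
by rewrite BDl !BDr !BZl !BZr Bxx (sympC w u); ring.
Qed.

Let transvection_move x y : B x y != 0 -> exists2 g, isometry g & g x = y.
Proof.
move=> xy; have BN a b : B a (- b) = - B a b by rewrite -scaleN1r BZr mulN1r.
exists (fun v => v + ((B x y)^-1 * B v (y - x)) *: (y - x)).
  exact: transvection_isometry.
by rewrite BDr BN Bxx subr0 mulVf // scale1r addrC subrK.
Qed.

(** A transvection along y - x moves x to y when B x y is non-zero; otherwise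
    go through a vector that is orthogonal to neither. *)
Lemma isometry_transitive x y : x != 0 -> y != 0 ->
  exists2 g, isometry g & g x = y.
Proof.
move=> x0 y0; have [xy|] := boolP (B x y != 0); first exact: transvection_move.
move/negPn/eqP => xy.
suff [z xz zy] : exists2 z, B x z != 0 & B z y != 0.
  have [g [gD gB] gx] := transvection_move xz.
  have [k [kD kB] kz] := transvection_move zy.
  exists (k \o g); last by rewrite /= gx.
  by split=> [v w|v w] /=; rewrite ?gD ?kD ?kB ?gB.
have [a xa] := Bnd x0; have [b yb] := Bnd y0.
have [ay|] := boolP (B a y != 0); first by exists a.
move/negPn/eqP => ay.
have [xb|] := boolP (B x b != 0); first by exists b; rewrite // sympC oppr_eq0.
move/negPn/eqP => xb.
by exists (a + b); rewrite ?BDr ?BDl ?xb ?ay ?addr0 ?add0r // sympC oppr_eq0.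
Qed.

(** When the multiplier vanishes only at 0, the kernel of an additive
    similitude lies in the radical of B. *)
Lemma similitude_inj (g : V -> V) (s : F -> F) :
    {morph g : x y / x + y} -> (forall z, s z = 0 -> z = 0) ->
    (forall x y, B (g x) (g y) = s (B x y)) ->
  injective g.
Proof.
move=> gD s0 gB x y gxy; apply/eqP; rewrite -subr_eq0; apply/negPn/negP => xy.
have [z] := Bnd xy; apply/negP/negPn/eqP/s0; rewrite -gB.
have -> : g (x - y) = 0 by apply: (@addIr _ (g y)); rewrite -gD subrK add0r.
by rewrite -(scale0r 0) BZl mul0r.
Qed.

End SymplecticForm.

(** * The group GammaL(1,q) *)

Section SemilinearPermutations.

Variable F : finFieldType.
Implicit Types (g : {perm F}) (U : {set F}).

Lemma GammaL1P g : g \in GammaL1 F -> exists l (s : {perm F}),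
  [/\ l != 0, s 1 = 1, {morph s : x y / x + y}, {morph s : x y / x * y}
    & forall x, g x = l * s x].
Proof.
rewrite inE => /existsP[l /existsP[s /and3P[l0 /and3P[/eqP s1 sD sM] /forallP gE]]].
exists l, s; split=> // [x y|x y|x]; last exact/eqP.
  exact/eqP/(forallP (forallP sD x)).
exact/eqP/(forallP (forallP sM x)).
Qed.

Lemma GammaL1D g : g \in GammaL1 F -> {morph g : x y / x + y}.
Proof. by case/GammaL1P=> l [s [_ _ sD _ gE]] x y; rewrite !gE sD mulrDr. Qed.

Lemma GammaL1_0 g : g \in GammaL1 F -> g 0 = 0.
Proof. by move=> /GammaL1D/morphD0. Qed.

Lemma GammaL1_Frobenius (p n : nat) (c : F) (j : nat) :
    p \in [pchar F] -> #|F| = (p ^ n)%N -> c != 0 ->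
  exists2 g, g \in GammaL1 F & forall z, g z = c * z ^+ (p ^ j).
Proof.
move=> pF cardF c0; have [k kE] := Frobenius_power_inv j cardF.
have powI : injective (fun x : F => x ^+ (p ^ j)).
  by move=> x y /= xy; rewrite -[x]kE xy kE.
pose s : {perm F} := perm powI.
have sE z : s z = z ^+ (p ^ j) by rewrite permE.
have gI : injective (fun z => c * s z).
  by move=> x y /(mulfI c0); apply: perm_inj.
exists (perm gI) => [|z]; last by rewrite permE sE.
rewrite inE; apply/existsP; exists c; apply/existsP; exists s.
rewrite c0 /=; apply/andP; split; last by apply/forallP => x; rewrite permE.
have p_nat : [pchar F].-nat (p ^ j)%N.
  by rewrite pnatX (eq_pnat _ (pcharf_eq pF)) pnat_id ?(pcharf_prime pF).
apply/and3P; split; first by rewrite sE expr1n.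
  by apply/'forall_'forall_eqP => x y; rewrite !sE exprDn_pchar.
by apply/'forall_'forall_eqP => x y; rewrite !sE exprMn.
Qed.

(** By finiteness, a permutation that maps U into U maps it onto U. *)
Lemma perm_stable_mem g U : (forall u, u \in U -> g u \in U) ->
  forall z, (g z \in U) = (z \in U).
Proof.
move=> gU z; apply/idP/idP => [|/gU//].
have gUE : g @: U = U.
  apply/eqP; rewrite eqEcard card_imset ?leqnn ?andbT; last exact: perm_inj.
  by apply/subsetP=> _ /imsetP[u /gU Uu ->].
by rewrite -{1}gUE => /imsetP[u Uu /perm_inj ->].
Qed.

End SemilinearPermutations.

(** * Automorphisms of Heisenberg groups *)

(** Heisenberg coordinates on G.  The last coordinate only matters modulo U,
    so that one record serves both for q^{1+2m}_+ and for its central quotients. *)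
Record heisenberg (F : finFieldType) (V : finLmodType F) (B : V -> V -> F)
    (gT : finGroupType) (G : {group gT}) (U : {set F}) (e : V -> F -> gT) : Prop :=
  Heisenberg {
    heisM : forall v z w y, (e v z * e w y)%g = e (v + w) (z + y + B v w / 2%:R);
    heis_eq : forall v z w y, e v z = e w y <-> v = w /\ z - y \in U;
    heisG : forall x, x \in G <-> exists v z, x = e v z }.

Section HeisenbergGroup.

Variables (p n : nat) (F : finFieldType) (V : finLmodType F) (B : V -> V -> F).
Hypotheses (pF : p \in [pchar F]) (p_odd : odd p) (cardF : #|F| = (p ^ n)%N).
Hypothesis sB : symplectic B.
Hypothesis simB : forall s, s \in GammaL1 F ->
  exists2 g : V -> V, {morph g : x y / x + y} & forall x y, B (g x) (g y) = s (B x y).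
Variable v0 : V.
Hypothesis v00 : v0 != 0.

Variables (gT : finGroupType) (G : {group gT}) (U : {set F}) (e : V -> F -> gT).
Hypothesis heis : heisenberg B G U e.
Variable w0 : F.
Hypothesis Uw0 : w0 \notin U.

Let eM := heisM heis.
Let eE := heis_eq heis.
Let eG := heisG heis.

Lemma two_neq0 : (2%:R : F) != 0.
Proof.
rewrite -(dvdn_pcharf pF) dvdn_prime2 ?(pcharf_prime pF) //.
by apply: contraTneq p_odd => ->.
Qed.

Lemma heis_subU : zmod_closed U.
Proof.
have U0 : 0 \in U by have [_] := (eE 0 0 0 0).1 erefl; rewrite subrr.
split=> // x y Ux Uy; have /eE[] // : e 0 x = e 0 y.
by rewrite ((eE 0 x 0 0).2 _) ?((eE 0 y 0 0).2 _) ?subr0.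
Qed.

Lemma mem_heis v z : e v z \in G.
Proof. by apply/eG; exists v, z. Qed.

Lemma heis1 : e 0 0 = 1%g.
Proof.
by apply: (@mulgI _ (e 0 0)); rewrite eM mulg1 symp0r // mul0r !addr0.
Qed.

Lemma heis_eq1 v z : e v z = 1%g <-> v = 0 /\ z \in U.
Proof. by rewrite -heis1 eE subr0. Qed.

(** The two orders of multiplication contribute B(v, w) / 2 and - B(v, w) / 2. *)
Lemma heis_swap v z w y : (e v z * e w y = e w y * e v z * e 0 (B v w))%g.
Proof.
have h2 := two_neq0.
rewrite !eM symp0r // mul0r !addr0 (addrC w v) (sympC sB v w).
by congr (e _ _); field.
Qed.

(** If v is non-zero then B(v, _) is onto F, so (v, z) fails to commute with
    some element as soon as U is proper. *)
Lemma heis_centerP x : reflect (exists z, x = e 0 z) (x \in 'Z(G)).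
Proof.
apply: (iffP (centerP G x)) => [[/eG[v [z ->]] cG]|[z ->]]; last first.
  split=> [|_ /eG[w [y ->]]]; first exact: mem_heis.
  have symp0l : B 0 w = 0 by rewrite (sympC sB) symp0r // oppr0.
  by rewrite /commute heis_swap symp0l heis1 mulg1.
exists z; have [->//|v_n0] := eqVneq v 0.
have [y By] := form_onto sB w0 v_n0; case/negP: Uw0.
suff /heis_eq1[] : e 0 w0 = 1%g by [].
apply: (@mulgI _ (e y 0 * e v z)%g); rewrite -By -heis_swap mulg1.
exact: cG (mem_heis y 0).
Qed.

(** The automorphisms used below.  The summand f contributes the central
    automorphisms (v, z) |-> (v, z + f v), which include the inner ones. *)
Lemma heis_Aut (g : V -> V) (s : {perm F}) (f : V -> F) :
    s \in GammaL1 F -> (forall u, u \in U -> s u \in U) ->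
    {morph g : x y / x + y} -> (forall x y, B (g x) (g y) = s (B x y)) ->
    {morph f : x y / x + y} ->
  exists2 a, a \in Aut G & forall v z, a (e v z) = e (g v) (s z + f v).
Proof.
move=> sG sU gD gB fD; have sD := GammaL1D sG; have s0 := GammaL1_0 sG.
have sB' := morphDB sD.
have gI : injective g.
  by apply: (similitude_inj sB gD _ gB) => z; rewrite -[in X in X -> _]s0 => /perm_inj.
(* The value does not depend on the coordinates picked, since s preserves U. *)
pose psi x : gT := if [pick vz : V * F | x == e vz.1 vz.2] is Some vz
  then e (g vz.1) (s vz.2 + f vz.1) else 1%g.
have psiE v z : psi (e v z) = e (g v) (s z + f v).
  rewrite /psi; case: pickP => [[w y] /= /eqP/eE[<- zy]|/(_ (v, z))]; last first.
    by rewrite /= eqxx.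
  apply/eE; split=> //.
  have -> : s y + f v - (s z + f v) = s (0 - (z - y)) by rewrite !sB' s0; ring.
  by case: heis_subU => U0 UB; apply/sU/UB.
have h2 := two_neq0.
have s2 t : s (t / 2%:R) = s t / 2%:R.
  have th : t = t / 2%:R + t / 2%:R by field.
  by apply: (mulIf h2); rewrite divfK // [in RHS]th sD; ring.
have psiM : {in G &, {morph psi : x y / (x * y)%g}}.
  move=> _ _ /eG[v [z ->]] /eG[w [y ->]]; rewrite eM !psiE eM gB gD fD !sD s2.
  by congr (e _ _); ring.
pose psim := Morphism psiM.
have injpsi : 'injm psim.
  apply/injmP => _ _ /eG[v [z ->]] /eG[w [y ->]] /=; rewrite !psiE.
  move=> /eE[/gI vw]; rewrite -vw => szy; apply/eE; split=> //.
  by rewrite -(perm_stable_mem sU) sB' (_ : _ - _ = s z + f v - (s y + f v)) //; ring.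
have imG : psim @* G = G.
  apply/eqP; rewrite eqEcard card_injm // leqnn andbT.
  apply/subsetP => _ /morphimP[_ _ /eG[v [z ->]] ->] /=; rewrite psiE.
  exact: mem_heis.
exists (aut injpsi imG); first exact: Aut_aut.
by move=> v z; rewrite autE ?mem_heis //= psiE.
Qed.

(** Any automorphism preserves the centre and the commutator, hence acts on
    G / Z(G) = V as an additive similitude modulo U whose multiplier is its
    action on the centre; the linear-algebra core then applies. *)
Lemma heis_Aut_center a : a \in Aut G -> exists s,
  [/\ s \in GammaL1 F, forall u, u \in U -> s u \in U
    & forall z, a (e 0 z) = e 0 (s z)].
Proof.
move=> Aa; have [U0 UB] := heis_subU.
have aM x y : x \in G -> y \in G -> a (x * y)%g = (a x * a y)%g.
  exact: (morphicP (Aut_morphic Aa)).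
have aG v z : a (e v z) \in G by rewrite Aut_closed ?mem_heis.
have a1 : a 1%g = 1%g by apply: (@mulgI _ (a 1%g)); rewrite -aM // !mulg1.
have aZ z : exists y, a (e 0 z) = e 0 y.
  apply/heis_centerP.
  have /charP[_ /(_ _ (injm_autm Aa) (im_autm Aa)) <-] := center_char G.
  by rewrite -(autmE Aa) mem_morphim ?mem_heis //; apply/heis_centerP; exists z.
pose h z := odflt 0 [pick y | a (e 0 z) == e 0 y].
have hE z : a (e 0 z) = e 0 (h z).
  rewrite /h; case: pickP => [y /eqP->//|ny]; have [y ay] := aZ z.
  by have := ny y; rewrite ay eqxx.
pose g v := odflt 0 [pick w | [exists y, a (e v 0) == e w y]].
have gE v : exists y, a (e v 0) = e (g v) y.
  rewrite /g; case: pickP => [w /existsP[y /eqP ->]|nw]; first by exists y.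
  have /eG[w [y ay]] := aG v 0; have := nw w => /existsP[].
  by exists y; rewrite ay.
have gD : {morph g : v w / v + w}.
  move=> v w; have [x xE] := gE v; have [y yE] := gE w; have [t tE] := gE (v + w).
  have : a (e (v + w)%R 0%R * e 0%R (B v w / 2%:R)%R)%g = a (e v 0%R * e w 0%R)%g.
    by rewrite !eM symp0r // !addr0 !add0r mul0r addr0.
  rewrite !aM ?mem_heis // tE hE xE yE !eM symp0r // mul0r !addr0.
  by case/eE.
have aB v w : B (g v) (g w) - h (B v w) \in U.
  have [x xE] := gE v; have [y yE] := gE w.
  have := congr1 a (heis_swap v 0 w 0).
  rewrite !aM ?groupM ?mem_heis // xE yE hE heis_swap => /mulgI/eE[_ ->//].
(* If g kills d <> 0 then a kills e 0 (B d y) for all y, so the whole centre. *)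
have gI : injective g.
  move=> v w gvw; apply/eqP; rewrite -subr_eq0; apply: contraNT Uw0 => vw.
  have gd0 : g (v - w) = 0 by apply: (@addIr _ (g w)); rewrite -gD subrK add0r.
  have [y yE] := form_onto sB w0 vw.
  have := aB (v - w) y; rewrite gd0 (sympC sB) symp0r // oppr0 add0r yE => Uh.
  suff /heis_eq1[] : e 0 w0 = 1%g by [].
  apply: (@perm_inj _ a); rewrite a1 hE; apply/heis_eq1; split=> //.
  by rewrite -[h _]opprK -sub0r UB.
have hD y z : h (y + z) - (h y + h z) \in U.
  have := congr1 a (eM 0 y 0 z).
  rewrite aM ?mem_heis // symp0r // mul0r !addr0 !hE eM symp0r // mul0r !addr0.
  by move/esym/eE=> [].
have hU u : u \in U -> h u \in U.
  move=> Uu; suff /heis_eq1[] : e 0 (h u) = 1%g by [].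
  by rewrite -hE (heis_eq1 0 u).2.
have [c [j [c0 cE]]] :=
  similitude_mod_semilinear sB pF cardF heis_subU Uw0 v00 gD gI hD aB.
have [s sG sE] := GammaL1_Frobenius j pF cardF c0.
exists s; split=> // [u Uu|z].
  have := UB _ _ (cE u); rewrite -sE => /(_ (- h u)); rewrite opprK subrK; apply.
  by rewrite -sub0r UB ?hU.
by rewrite hE; apply/eE; split=> //; rewrite sE -opprB -sub0r UB.
Qed.

Lemma heis_Aut_realize s : s \in GammaL1 F -> (forall u, u \in U -> s u \in U) ->
  exists2 a, a \in Aut G & forall z, a (e 0 z) = e 0 (s z).
Proof.
move=> sG sU; have [g gD gB] := simB sG.
have f0D : {morph (fun _ : V => 0 : F) : x y / x + y} by move=> ? ?; rewrite addr0.
have [a Aa aE] := heis_Aut sG sU gD gB f0D; exists a => // z.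
by rewrite aE addr0 (morphD0 gD).
Qed.

(** An isometry takes v to w; then add the central correction
    B(_, x), which can take any value at v because v is non-zero. *)
Lemma heis_Aut_trans v z w y : v != 0 -> w != 0 ->
  exists2 a, a \in Aut G & a (e v z) = e w y.
Proof.
move=> v_n0 w_n0; have [g [gD gB] gv] := isometry_transitive sB v_n0 w_n0.
have [x xE] := form_onto sB (y - z) v_n0.
have fD : {morph B^~ x : a b / a + b} by move=> a b; rewrite (sympDl sB).
have gB1 a b : B (g a) (g b) = (1%g : {perm F}) (B a b) by rewrite perm1.
have [|a Aa aE] := heis_Aut (group1 (GammaL1 F)) _ gD gB1 fD.
  by move=> u; rewrite perm1.
by exists a; rewrite // aE perm1 gv xE addrC subrK.
Qed.

(** The identity and a non-central element give two orbits, and all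
    non-central elements are conjugate under Aut(G), so three orbits means that
    the non-trivial central elements form one. *)
Lemma three_orbit_heisP : three_orbit G <->
  forall z y, z \notin U -> y \notin U -> exists s,
    [/\ s \in GammaL1 F, forall u, u \in U -> s u \in U & s z - y \in U].
Proof.
pose O x := orbit 'P (Aut G) x.
have OP x y : O x = O y <-> exists2 a, a \in Aut G & a y = x.
  split=> [/orbit_eqP/orbitP[a Aa <-]|[a Aa <-]]; first by exists a.
  by apply/orbit_eqP/orbitP; exists a.
have O1 x : O x = O 1%g <-> x = 1%g.
  split=> [/esym/OP[a Aa ax]|->//].
  apply: (@perm_inj _ a); rewrite ax.
  by rewrite -(autmE Aa) morph1.
have e1 z : z \notin U -> e 0 z != 1%g.
  by apply: contraNneq => /heis_eq1[].
have ev v z : v != 0 -> e v z != 1%g.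
  by apply: contra_neq => /heis_eq1[].
have Ocv v z y : v != 0 -> O (e v y) != O (e 0 z).
  move=> v_n0; apply/eqP => /OP[a Aa ae].
  have [s [_ _ sE]] := heis_Aut_center Aa; move: ae; rewrite sE => /eE[/esym/eqP].
  by rewrite (negPf v_n0).
split=> [/eqP O3 z y Uz Uy|tr].
  have [/esym/OP[a Aa ay]|Ozy] := eqVneq (O (e 0 z)) (O (e 0 y)).
    have [s [sG sU sE]] := heis_Aut_center Aa; exists s; split=> //.
    by move: ay; rewrite sE => /eE[].
  (* Otherwise there would be four orbits. *)
  pose r := [:: O 1%g; O (e 0 z); O (e 0 y); O (e v0 0)].
  have ur : uniq r.
    rewrite /= !inE !negb_or Ozy [O (e 0 z) == O (e v0 0)]eq_sym Ocv //.
    rewrite [O (e 0 y) == O (e v0 0)]eq_sym Ocv //= !andbT.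
    by apply/and3P; split; apply/eqP => /esym/O1/eqP; apply/negP; rewrite ?e1 ?ev.
  have : (size r <= #|O @: G|)%N.
    rewrite cardE uniq_leq_size // => x.
    rewrite mem_enum !inE => /or4P[]/eqP->; apply: imset_f; rewrite ?group1 ?mem_heis //.
  by rewrite O3.
have OG : O @: G = O 1%g |: [set O (e 0 w0); O (e v0 0)].
  apply/setP => X; rewrite !inE; apply/imsetP/or3P => [[x /eG[v [z ->]] ->]|].
    have [->|v_n0] := eqVneq v 0; last first.
      by apply: Or33; apply/eqP/OP; apply: heis_Aut_trans.
    have [Uz|Uz] := boolP (z \in U).
      by apply: Or31; rewrite (heis_eq1 0 z).2.
    apply: Or32; have [s [sG sU sz]] := tr w0 z Uw0 Uz.
    have [a Aa aE] := heis_Aut_realize sG sU.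
    by apply/eqP/OP; exists a; rewrite // aE; apply/eE.
  by case=> /eqP->; [exists 1%g | exists (e 0 w0) | exists (e v0 0)]; rewrite ?mem_heis.
rewrite /three_orbit -/O OG cardsU1 cards2 !inE negb_or.
rewrite [O (e 0 w0) == _]eq_sym Ocv //.
have -> : O 1%g != O (e 0 w0) by apply/eqP => /esym/O1/eqP; apply/negP/e1.
have -> // : O 1%g != O (e v0 0) by apply/eqP => /esym/O1/eqP; apply/negP/ev.
Qed.

End HeisenbergGroup.

(** * Heisenberg coordinates on the central product *)

Section SymplecticRows.

Variables (F : finFieldType) (m : nat).
Implicit Types v w : 'rV[F]_(m + m).

Definition row_symp v w : F :=
  \sum_(i < m) (v 0 (lshift m i) * w 0 (rshift m i)
                - w 0 (lshift m i) * v 0 (rshift m i)).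

Lemma row_symp_symplectic : symplectic row_symp.
Proof.
split=> [x y z|z x y|c x y|c x y|x|x x0].
- by rewrite -big_split; apply: eq_bigr => i _; rewrite !mxE /=; ring.
- by rewrite -big_split; apply: eq_bigr => i _; rewrite !mxE /=; ring.
- by rewrite big_distrr; apply: eq_bigr => i _; rewrite !mxE /=; ring.
- by rewrite big_distrr; apply: eq_bigr => i _; rewrite !mxE /=; ring.
- by apply: big1 => i _; rewrite subrr.
have [j xj] : exists j, x 0 j != 0.
  apply/existsP; apply: contraR x0; rewrite negb_exists => /forallP x0.
  by apply/eqP/rowP => j; rewrite mxE; have /negPn/eqP := x0 j.
have [i ij|i ij] := split_ordP j; rewrite {j}ij in xj.
  exists (delta_mx 0 (rshift m i)); rewrite /row_symp (bigD1 i) //= big1.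
    by rewrite !mxE !eqxx eq_lrshift /= mulr1 mul0r subr0 addr0.
  move=> k ki; rewrite !mxE !eqxx eq_lrshift /= eq_rshift (negPf ki).
  by rewrite mulr0 mul0r subr0.
exists (delta_mx 0 (lshift m i)); rewrite /row_symp (bigD1 i) //= big1.
  by rewrite !mxE !eqxx eq_rlshift /= mul1r mulr0 sub0r addr0 oppr_eq0.
move=> k ki; rewrite !mxE !eqxx eq_rlshift /= eq_lshift (negPf ki).
by rewrite mulr0 mul0r subr0.
Qed.

(** For s = l t with t a field automorphism, apply l t to the first m
    coordinates and t to the last m. *)
Lemma row_symp_similitude (s : {perm F}) : s \in GammaL1 F ->
  exists2 g : 'rV[F]_(m + m) -> 'rV[F]_(m + m), {morph g : x y / x + y}
    & forall x y, row_symp (g x) (g y) = s (row_symp x y).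
Proof.
case/GammaL1P=> l [t [l0 t1 tD tM sE]].
have t0 := morphD0 tD.
have tB := morphDB tD.
exists (fun v => \row_j (if (j < m)%N then l * t (v 0 j) else t (v 0 j))).
  by move=> x y; apply/rowP => j; rewrite !mxE tD; case: ifP; rewrite ?mulrDr.
move=> x y; rewrite sE (big_morph t tD t0) big_distrr; apply: eq_bigr => i _.
by rewrite !mxE /= ltn_ord ltnNge leq_addr /= tB !tM; ring.
Qed.

End SymplecticRows.

Section Unitriangular.

Variable F : finFieldType.

Definition utri_mx (a b c : F) : 'M[F]_3 :=
  \matrix_(i, j) nth 0 (nth [::] [:: [:: 1; a; c]; [:: 0; 1; b]; [:: 0; 0; 1]] i) j.

Lemma utri_mxM a b c a' b' c' :
  utri_mx a b c *m utri_mx a' b' c' = utri_mx (a + a') (b + b') (c + c' + a * b').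
Proof.
apply/matrixP => i j; rewrite mxE !big_ord_recl big_ord0 !mxE /=.
by case: i => [[|[|[|i]]] //= _]; case: j => [[|[|[|j]]] //= _]; ring.
Qed.

Lemma utri_mx1 : utri_mx 0 0 0 = 1%:M.
Proof.
apply/matrixP => i j; rewrite !mxE.
by case: i => [[|[|[|i]]] //= hi]; case: j => [[|[|[|j]]] //= hj].
Qed.

Lemma utri_unit a b c : utri_mx a b c \is a GRing.unit.
Proof.
have /mulmx1_unit[] // : utri_mx a b c *m utri_mx (- a) (- b) (a * b - c) = 1%:M.
by rewrite utri_mxM -utri_mx1; congr utri_mx; ring.
Qed.

Definition utri a b c : {'GL_3[F]} := FinRing.unit _ (utri_unit a b c).

Lemma utriM a b c a' b' c' :
  (utri a b c * utri a' b' c')%g = utri (a + a') (b + b') (c + c' + a * b').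
Proof. by apply: val_inj; apply: utri_mxM. Qed.

Lemma utri1 : utri 0 0 0 = 1%g.
Proof. by apply: val_inj; apply: utri_mx1. Qed.

Lemma utri_inj a b c a' b' c' :
  utri a b c = utri a' b' c' -> [/\ a = a', b = b' & c = c'].
Proof.
move=> /(congr1 val)/matrixP E.
have := E 0 1; rewrite !mxE /= => ->; have := E 0 (inord 2); have := E 1 (inord 2).
by rewrite !mxE /= !inordK //= => -> ->.
Qed.

Lemma mem_UT3 x : reflect (exists a b c, x = utri a b c) (x \in UT3 F).
Proof.
apply: (iffP idP) => [|[a [b [c ->]]]].
  rewrite inE => /forallP xU.
  exists (GLval x 0 1), (GLval x 1 (inord 2)), (GLval x 0 (inord 2)).
  apply: val_inj; apply/matrixP => i j; rewrite mxE.
  have := forallP (xU i) j.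
  case: i => [[|[|[|i]]] //= hi]; case: j => [[|[|[|j]]] //= hj];
    move=> /eqP // ; rewrite ?eqxx // => E; rewrite -?E //;
    by congr (fun_of_matrix _ _ _); apply: val_inj; rewrite //= inordK.
rewrite inE; apply/forallP => i; apply/forallP => j; rewrite mxE.
by case: i => [[|[|[|i]]] //= hi]; case: j => [[|[|[|j]]] //= hj].
Qed.

Lemma mem_center_UT3 x : reflect (exists c, x = utri 0 0 c) (x \in 'Z(UT3 F)).
Proof.
apply: (iffP (centerP _ x)) => [[/mem_UT3[a [b [c ->]]] cx]|[c ->]].
  have U y z t : utri y z t \in UT3 F by apply/mem_UT3; exists y, z, t.
  have := cx _ (U 1 0 0); have := cx _ (U 0 1 0); rewrite /commute !utriM.
  move=> /utri_inj[_ _ e1] /utri_inj[_ _ e2]; exists c; congr utri.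
    by move: e1; rewrite mulr1 mul0r !addr0 add0r -[RHS]addr0 => /addrI.
  by move: e2; rewrite mulr0 mul1r !addr0 add0r -[LHS]addr0 => /addrI/esym.
split=> [|_ /mem_UT3[a [b [d ->]]]]; first by apply/mem_UT3; exists 0, 0, c.
by rewrite /commute !utriM; congr utri; ring.
Qed.

End Unitriangular.

Section CentralProductParametrization.

Variables (F : finFieldType) (m : nat) (i0 : 'I_m).
Hypothesis two_n0 : (2%:R : F) != 0.

Local Notation gT := {dffun forall i : 'I_m, {'GL_3[F]}}.

Definition utri_tuple (a b c : 'I_m -> F) : gT := [ffun i => utri (a i) (b i) (c i)].

Lemma utri_tupleM a b c a' b' c' :
  (utri_tuple a b c * utri_tuple a' b' c')%g =
  utri_tuple (fun i => a i + a' i) (fun i => b i + b' i)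
    (fun i => c i + c' i + a i * b' i).
Proof. by apply/ffunP => i; rewrite !ffunE utriM. Qed.

Lemma eq_utri_tuple a b c a' b' c' :
  a =1 a' -> b =1 b' -> c =1 c' -> utri_tuple a b c = utri_tuple a' b' c'.
Proof. by move=> ea eb ec; apply/ffunP => i; rewrite !ffunE ea eb ec. Qed.

Lemma mem_UT3_pow X :
  reflect (exists a b c, X = utri_tuple a b c) (X \in UT3_pow F m).
Proof.
rewrite in_setXn; apply: (iffP forallP) => [UX|[a [b [c ->]]] i]; last first.
  by rewrite ffunE; apply/mem_UT3; exists (a i), (b i), (c i).
have /fin_all_exists[a /fin_all_exists[b /fin_all_exists[c XE]]] :
    forall i, exists a b c, X i = utri a b c.
  by move=> i; apply/mem_UT3.
by exists a, b, c; apply/ffunP => i; rewrite ffunE.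
Qed.

Lemma mem_amalg X : reflect
  (exists2 c, X = utri_tuple (fun=> 0) (fun=> 0) c & \sum_i c i = 0)
  (X \in amalg F m).
Proof.
have prodE (c : 'I_m -> F) : (\prod_i utri 0 0 (c i))%g = utri 0 0 (\sum_i c i).
  symmetry; apply: (big_morph (fun t => utri 0 0 t)) => [x y|]; last exact: utri1.
  by rewrite utriM; congr utri; ring.
rewrite inE in_setXn; apply: (iffP andP) => [[/forallP ZX]|[c -> c0]].
  have /fin_all_exists[c XE] : forall i, exists c, X i = utri 0 0 c.
    by move=> i; apply/mem_center_UT3.
  rewrite (eq_bigr _ (fun i _ => XE i)) prodE -utri1 => /eqP/utri_inj[_ _ c0].
  by exists c => //; apply/ffunP => i; rewrite ffunE.
split; first by apply/forallP => i; rewrite ffunE; apply/mem_center_UT3; exists (c i).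
by under eq_bigr do rewrite ffunE; rewrite prodE c0 utri1.
Qed.

Lemma norm_amalg : UT3_pow F m \subset 'N(amalg F m).
Proof.
apply/cents_norm/centsP => _ /mem_UT3_pow[a [b [c ->]]] _ /mem_amalg[d -> _].
by rewrite /commute !utri_tupleM; apply: eq_utri_tuple => i; ring.
Qed.

(** In the central product only the sum of the central entries survives. *)
Lemma eq_coset_utri_tuple a b c a' b' c' :
  coset (amalg F m) (utri_tuple a b c) = coset (amalg F m) (utri_tuple a' b' c')
  <-> [/\ a =1 a', b =1 b' & \sum_i c i = \sum_i c' i].
Proof.
have N x y z : utri_tuple x y z \in 'N(amalg F m).
  by apply: (subsetP norm_amalg); apply/mem_UT3_pow; exists x, y, z.
split=> [/rcoset_kercosetP|[ea eb ec]].
  move=> /(_ (N _ _ _) (N _ _ _))/rcosetP[_ /mem_amalg[d -> d0]].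
  rewrite utri_tupleM => /ffunP E.
  have {}E i : [/\ a i = a' i, b i = b' i & c i = d i + c' i].
    have := E i; rewrite !ffunE => /utri_inj[-> -> ->].
    by rewrite !add0r mul0r addr0.
  split=> [i|i|]; try by have [] := E i.
  under eq_bigr => i _ do have [_ _ ->] := E i.
  by rewrite big_split /= d0 add0r.
apply/rcoset_kercosetP=> //; apply/rcosetP.
exists (utri_tuple (fun=> 0) (fun=> 0) (fun i => c i - c' i)).
  by apply/mem_amalg; exists (fun i => c i - c' i); rewrite // sumrB ec subrr.
by rewrite utri_tupleM; apply: eq_utri_tuple => i; rewrite ?ea ?eb; ring.
Qed.

(** The total central entry is put in the single factor i0.  The shift by half
    of the pairing of the two halves of v turns the bilinear cocycle of matrix
    multiplication into the alternating one. *)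
Definition extraspecial_elt (v : 'rV[F]_(m + m)) (z : F) : coset_of (amalg F m) :=
  coset (amalg F m)
    (utri_tuple (fun i => v 0 (lshift m i)) (fun i => v 0 (rshift m i))
       (fun i => if i == i0
          then z + (\sum_j v 0 (lshift m j) * v 0 (rshift m j)) / 2%:R else 0)).

(** Expanding (v + w) in the shift produces half of each mixed pairing; against
    the full pairing coming from the matrix product this leaves B(v, w) / 2. *)
Lemma extraspecial_heisenberg :
  heisenberg (@row_symp F m) (extraspecial_q F m) [set 0] extraspecial_elt.
Proof.
have N x y z : utri_tuple x y z \in 'N(amalg F m).
  by apply: (subsetP norm_amalg); apply/mem_UT3_pow; exists x, y, z.
have sum0 t : \sum_i (if i == i0 then t else 0) = t :> F.
  by rewrite -big_mkcond big_pred1_eq.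
split=> [v z w y|v z w y|x].
- rewrite /extraspecial_elt -morphM ?N // utri_tupleM.
  apply/eq_coset_utri_tuple; split=> [i|i|]; rewrite ?mxE //.
  rewrite !big_split /= !sum0 /row_symp sumrB.
  under [\sum_(j < m) ((v + w) 0 _ * _)]eq_bigr => j _ do
    rewrite !mxE mulrDl !mulrDr.
  rewrite !big_split /=.
  by field.
- split=> [/eq_coset_utri_tuple[el er]|[->]].
    rewrite !sum0 => ez.
    have vw : v = w by apply/rowP => i; have [j ->|j ->] := split_ordP i.
    by rewrite vw in ez *; split=> //; apply/set1P; move/addIr: ez => ->; rewrite subrr.
  by move=> /set1P/eqP; rewrite subr_eq0 => /eqP->.
split=> [/morphimP[X NX /mem_UT3_pow[a [b [c ->]]] ->]|[v [z ->]]]; last first.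
  by apply: mem_quotient; apply/mem_UT3_pow; do 3!eexists.
pose v := row_mx (\row_i a i) (\row_i b i).
exists v, (\sum_i c i - (\sum_j a j * b j) / 2%:R); apply/eq_coset_utri_tuple.
split=> [i|i|]; rewrite ?row_mxEl ?row_mxEr ?mxE // sum0.
under [X in _ + X / _]eq_bigr do rewrite row_mxEl row_mxEr !mxE.
by rewrite subrK.
Qed.

End CentralProductParametrization.

(** * The action on the centre and its quotient *)

Section CenterAction.

Variables (p n : nat) (F : finFieldType) (V : finLmodType F) (B : V -> V -> F).
Hypotheses (pF : p \in [pchar F]) (p_odd : odd p) (cardF : #|F| = (p ^ n)%N).
Hypothesis sB : symplectic B.
Hypothesis simB : forall s, s \in GammaL1 F ->
  exists2 g : V -> V, {morph g : x y / x + y} & forall x y, B (g x) (g y) = s (B x y).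
Variable v0 : V.
Hypothesis v00 : v0 != 0.

Variables (gT : finGroupType) (G : {group gT}) (e : V -> F -> gT).
Hypothesis heis : heisenberg B G [set 0] e.

Let eM := heisM heis.
Let eE := heis_eq heis.
Let eG := heisG heis.

Let U1 : (1 : F) \notin [set 0 : F].
Proof. by rewrite inE oner_eq0. Qed.

Let ZP x : reflect (exists z, x = e 0 z) (x \in 'Z(G)).
Proof. exact: (heis_centerP pF p_odd sB heis U1). Qed.

Let e0I z y : e 0 z = e 0 y -> z = y.
Proof. by case/eE=> _ /set1P/eqP; rewrite subr_eq0 => /eqP. Qed.

(** Transports a permutation of F to the centre, with the identity elsewhere, as
    in the definition of the group induced on the centre. *)
Definition center_perm_fun (s : {perm F}) (x : gT) : gT :=
  if [pick z | x == e 0 z] is Some z then e 0 (s z) else x.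

Let funE s z : center_perm_fun s (e 0 z) = e 0 (s z).
Proof.
rewrite /center_perm_fun; case: pickP => [y /eqP/e0I -> //|/(_ z)].
by rewrite eqxx.
Qed.

Let fun_out s x : x \notin 'Z(G) -> center_perm_fun s x = x.
Proof.
move=> nZ; rewrite /center_perm_fun; case: pickP => // z /eqP xE.
by case/ZP: nZ; exists z.
Qed.

Lemma center_perm_fun_inj s : injective (center_perm_fun s).
Proof.
have Zs x : (center_perm_fun s x \in 'Z(G)) = (x \in 'Z(G)).
  have [/ZP[z ->]|nZ] := boolP (x \in 'Z(G)); last by rewrite fun_out ?(negPf nZ).
  by rewrite funE; apply/ZP; exists (s z).
move=> x y xy; have := Zs x; rewrite xy Zs; have [/ZP[z xE]|nZ] := boolP (x \in 'Z(G)).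
  by case/ZP=> t yE; move: xy; rewrite xE yE !funE => /e0I/perm_inj->.
by move=> nZ'; move: xy; rewrite !fun_out // nZ'.
Qed.

Definition center_perm (s : {perm F}) : {perm gT} := perm (@center_perm_fun_inj s).

Lemma center_permE s z : center_perm s (e 0 z) = e 0 (s z).
Proof. by rewrite permE funE. Qed.

Lemma center_perm_out s x : x \notin 'Z(G) -> center_perm s x = x.
Proof. by move=> nZ; rewrite permE fun_out. Qed.

Lemma center_permM : {in [set: {perm F}] &, {morph center_perm : s t / (s * t)%g}}.
Proof.
move=> s t _ _; apply/permP => x; rewrite permM.
have [/ZP[z ->]|nZ] := boolP (x \in 'Z(G)); first by rewrite !center_permE permM.
by rewrite !center_perm_out.
Qed.

Canonical center_perm_morphism := Morphism center_permM.

Lemma injm_center_perm : 'injm center_perm.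
Proof.
apply/injmP => s t _ _ st; apply/permP => z; apply: e0I.
by rewrite -!center_permE st.
Qed.

(** Both inclusions are the correspondence between automorphisms and
    GammaL(1,q), for the trivial subgroup of F. *)
Lemma Aut_on_centerE : Aut_on_center G :=: center_perm @* GammaL1 F.
Proof.
have nZ a : a \in Aut G -> a \in 'N('Z(G) | 'P).
  move=> Aa; rewrite !inE; apply/subsetP => _ /ZP[z ->]; rewrite inE /=.
  have [s [_ _ sE]] := heis_Aut_center pF p_odd cardF sB v00 heis U1 Aa.
  by apply/ZP; exists (s z); rewrite -sE.
have agree a (s : {perm F}) : a \in Aut G -> (forall z, a (e 0 z) = e 0 (s z)) ->
    restr_perm 'Z(G) a = center_perm s.
  move=> Aa aE; apply/permP => x; have [Zx|nZx] := boolP (x \in 'Z(G)).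
    by rewrite restr_permE ?nZ //; case/ZP: Zx => z ->; rewrite center_permE aE.
  by rewrite center_perm_out // (out_perm (restr_perm_on _ _)).
apply/setP => h; apply/morphimP/morphimP => [[a _ Aa ->]|[s _ sG ->]].
  have [s [sG _ sE]] := heis_Aut_center pF p_odd cardF sB v00 heis U1 Aa.
  by exists s; rewrite ?in_setT //; apply: agree.
have [|a Aa aE] := heis_Aut_realize pF p_odd sB simB heis sG.
  by move=> u /set1P ->; rewrite (GammaL1_0 sG) set11.
by exists a; rewrite ?nZ //; apply/esym/agree.
Qed.

Lemma Aut_on_center_isog : Aut_on_center G \isog GammaL1 F.
Proof.
rewrite isog_sym Aut_on_centerE.
by rewrite sub_isog ?subsetT ?injm_center_perm.
Qed.

Variable W : {group gT}.
Hypothesis ltWZ : W \proper 'Z(G).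

Definition center_coord : {set F} := [set z | e 0 z \in W].

(** Passing to G / W only coarsens equality of the last coordinate. *)
Lemma heis_quotient :
  heisenberg B (G / W)%G center_coord (fun v z => coset W (e v z)).
Proof.
have sWZ := proper_sub ltWZ.
have nWG : G \subset 'N(W)%g.
  by apply: cents_norm; rewrite centsC (subset_trans sWZ) ?subsetIr.
have N v z : e v z \in 'N(W) by apply: (subsetP nWG); apply/eG; exists v, z.
split=> [v z w y|v z w y|x]; first by rewrite -morphM ?N // eM.
  split=> [/rcoset_kercosetP|[-> ]].
    move=> /(_ (N _ _) (N _ _))/rcosetP[u Wu].
    have /ZP[t uE] := subsetP sWZ u Wu.
    rewrite uE eM (sympC sB) symp0r // oppr0 mul0r addr0 add0r => /eE[-> /set1P/eqP].
    by rewrite subr_eq0 => /eqP ->; split=> //; rewrite addrK inE -uE.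
  rewrite inE => Wzy; apply/rcoset_kercosetP; rewrite ?N //; apply/rcosetP.
  exists (e 0 (z - y)); rewrite // eM (sympC sB) symp0r // oppr0 mul0r addr0 add0r.
  by rewrite subrK.
split=> [/morphimP[_ _ /eG[v [z ->]] ->]|[v [z ->]]]; first by exists v, z.
by apply: mem_quotient; apply/eG; exists v, z.
Qed.

Lemma center_coord_proper : exists w, w \notin center_coord.
Proof.
have /properP[_ [_ /ZP[w ->] nW]] := ltWZ; by exists w; rewrite inE.
Qed.

Lemma center_norm : 'Z(G) \subset 'N(W).
Proof.
apply: cents_norm; rewrite centsC (subset_trans (proper_sub ltWZ)) //.
by rewrite (subset_trans (subsetIr _ _)) ?centS ?subsetIl.
Qed.

Lemma quotient_center : ('Z(G) / W = 'Z(G / W))%g.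
Proof.
have [w Uw] := center_coord_proper.
apply/setP => x; apply/morphimP/(heis_centerP pF p_odd sB heis_quotient Uw).
  by case=> _ _ /ZP[z ->] ->; exists z.
case=> z ->; have Zz : e 0 z \in 'Z(G) by apply/ZP; exists z.
by exists (e 0 z); rewrite ?(subsetP center_norm).
Qed.

Lemma stab_center_permP h : reflect
  (exists s, [/\ s \in GammaL1 F, forall u, u \in center_coord -> s u \in center_coord
     & h = center_perm s])
  (h \in 'N_(Aut_on_center G)(W | 'P)).
Proof.
rewrite Aut_on_centerE in_setI; apply: (iffP andP) => [[/morphimP[s _ sG ->]]|].
  rewrite !inE => /subsetP sW; exists s; split=> // u; rewrite !inE => Wu.
  by rewrite -center_permE; have := sW _ Wu; rewrite inE.
case=> s [sG sU ->]; split; first by apply: mem_morphim; rewrite ?in_setT.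
rewrite !inE; apply/subsetP => x Wx; rewrite inE /=.
have /ZP[z xE] := subsetP (proper_sub ltWZ) x Wx.
have := sU z; rewrite !inE -xE => /(_ Wx).
by rewrite xE /aperm center_permE.
Qed.

(** The quotient action is defined on the permutations that preserve the cosets
    of W in its whole normalizer.  A central coset is mapped to a central coset
    by additivity, and cosets outside the centre are fixed pointwise. *)
Lemma stab_sub_qact_dom : 'N_(Aut_on_center G)(W | 'P) \subset qact_dom 'P W.
Proof.
have sWZ := proper_sub ltWZ.
apply/subsetP => _ /stab_center_permP[s [sG sU ->]].
rewrite !inE; apply/subsetP => _ /rcosetsP[x Nx ->]; rewrite inE /=.
have Nsx : center_perm s x \in 'N(W).
  have [/ZP[z ->]|nZ] := boolP (x \in 'Z(G)); last by rewrite center_perm_out.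
  by rewrite center_permE (subsetP center_norm) //; apply/ZP; exists (s z).
apply/rcosetsP; exists (center_perm s x) => //; apply/eqP.
rewrite eqEcard card_imset ?card_rcoset ?leqnn ?andbT; last exact: perm_inj.
apply/subsetP => _ /imsetP[_ /rcosetP[u Wu ->] ->]; rewrite /= /aperm.
have Zu := subsetP sWZ u Wu.
have [/ZP[z ->]|nZ] := boolP (x \in 'Z(G)); last first.
  by rewrite !center_perm_out ?groupMl // mem_rcoset mulgK.
have /ZP[t uE] := Zu; have sWt : e 0 (s t) \in W.
  by have := sU t; rewrite !inE -uE; apply.
rewrite uE eM symp0r // mul0r !addr0 !center_permE (GammaL1D sG).
by apply/rcosetP; exists (e 0 (s t)); rewrite // eM symp0r // mul0r !addr0.
Qed.

Lemma qact_center_perm h s z : h \in 'N_(Aut_on_center G)(W | 'P) ->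
  h = center_perm s -> ('P / W)%act (coset W (e 0 z)) h = coset W (e 0 (s z)).
Proof.
move=> hN hE; rewrite qactE ?(subsetP stab_sub_qact_dom) //.
  by rewrite hE /= /aperm center_permE.
by rewrite (subsetP center_norm) //; apply/ZP; exists z.
Qed.

Lemma mem_quotient_center x : reflect
  (exists2 z, z \notin center_coord & x = coset W (e 0 z)) (x \in (('Z(G) / W)^#)%g).
Proof.
apply: (iffP setD1P) => [[x1 /morphimP[_ _ /ZP[z ->] xE]]|[z Uz ->]].
  exists z => //; apply: contraNN x1; rewrite inE xE => Wz.
  exact/eqP/coset_id.
split; last by apply: mem_quotient; apply/ZP; exists z.
by apply: contraNneq Uz => /(heis_eq1 sB heis_quotient)[].
Qed.

(** This condition on F is the one that characterizes three orbits for
    the Heisenberg group G / W. *)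
Lemma transitive_quotient_centerP :
  [transitive 'N_(Aut_on_center G)(W | 'P), on (('Z(G) / W)^#)%g | 'P / W] <->
  forall z y, z \notin center_coord -> y \notin center_coord -> exists s,
    [/\ s \in GammaL1 F, forall u, u \in center_coord -> s u \in center_coord
      & s z - y \in center_coord].
Proof.
have QE z y := heis_eq heis_quotient 0 z 0 y.
split=> [tr z y Uz Uy|tr].
  have orbE := atransPin stab_sub_qact_dom tr.
  have Sz : coset W (e 0 z) \in (('Z(G) / W)^#)%g by apply/mem_quotient_center; exists z.
  have : coset W (e 0 y) \in (('Z(G) / W)^#)%g by apply/mem_quotient_center; exists y.
  rewrite -(orbE _ Sz) => /imsetP[h hN].
  have /stab_center_permP[s [sG sU hE]] := hN.
  rewrite (qact_center_perm _ hN hE) => /esym/QE[_ szy].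
  by exists s.
have [w Uw] := center_coord_proper.
apply/imsetP; exists (coset W (e 0 w)); first by apply/mem_quotient_center; exists w.
apply/setP => x; apply/mem_quotient_center/imsetP => [[y Uy ->]|[h hN ->]].
  have [s [sG sU swy]] := tr w y Uw Uy.
  have hN : center_perm s \in 'N_(Aut_on_center G)(W | 'P).
    by apply/stab_center_permP; exists s.
  by exists (center_perm s); rewrite // (qact_center_perm _ hN erefl); apply/esym/QE.
have /stab_center_permP[s [sG sU hE]] := hN.
rewrite (qact_center_perm _ hN hE); exists (s w) => //.
by rewrite (perm_stable_mem sU).
Qed.

End CenterAction.

Local Close Scope ring_scope.

Theorem corollary1p1 (p n m : nat) (F : finFieldType)
    (p_prime : prime p) (p_odd : odd p) (n_ge1 : 1 <= n) (m_ge1 : 1 <= m)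
    (card_F : #|F| = (p ^ n)%N)
    (U : {group coset_of (amalg F m)})
    (ltUZ : U \proper 'Z(extraspecial_q F m)) :
  let N := extraspecial_q F m in
  let H := Aut_on_center N in
  [/\ H \isog GammaL1 F,
      'Z(N) / U = 'Z(N / U)
    & three_orbit (N / U)%G <->
      [transitive 'N_H(U | 'P), on ('Z(N) / U)^# | 'P / U]].
Proof.
move=> N H; have pF := card_finPcharP card_F p_prime.
pose i0 := Ordinal m_ge1.
have sB := row_symp_symplectic F m; have simB := @row_symp_similitude F m.
have heis := extraspecial_heisenberg i0 (two_neq0 pF p_odd).
have v00 : (const_mx 1 : 'rV[F]_(m + m))%R != 0%R.
  apply/eqP => /rowP/(_ (lshift m i0)); rewrite !mxE => /eqP.
  by rewrite oner_eq0.
have [w Uw] := center_coord_proper pF p_odd sB heis ltUZ.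
split.
- exact: (Aut_on_center_isog pF p_odd card_F sB simB v00 heis).
- exact: (quotient_center pF p_odd sB heis ltUZ).
have heisQ := heis_quotient pF p_odd sB heis ltUZ.
refine (iff_trans (three_orbit_heisP pF p_odd card_F sB simB v00 heisQ Uw) _).
by case: (transitive_quotient_centerP pF p_odd card_F sB simB v00 heis ltUZ).
Qed.
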